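(* Let $\lambda\in\mathbb{C}$ with $\operatorname{Re}\lambda<0$, let $\{h_n\}_{n=0}^\infty$ be a sequence of positive step sizes, $w_n=h_n/h_{n-1}$, and $\mu_n:=\lambda(h_{n+1}-h_n)$. The two-step variable step-size linear multistep method $$x_{n+2}-(5-3w_{n+1})x_{n+1}+(4-3w_{n+1})x_n = h_{n+1}\left(\frac{w_{n+1}-1}{w_{n+1}}\right)\Big((20-12w_{n+1})\,g(x_{n+1})-(16-12w_{n+1})\,g(x_{n})\Big)$$ is absolutely stable if and only if $\{h_n\}_{n=0}^\infty$ satisfies the following two conditions: - the sequence $\{\mu_n\}_{n=0}^\infty$ converges as $n\to\infty$ (its limit is denoted by $\mu$); - all roots of the polynomial $z^2-2(1+4\mu)z+(1+4\mu)$ lie in the open unit disk $\{|z|<1\}$. In particular, when $\mu\in\mathbb{R}$, the second condition is equivalent to $\mu\in\left(-\tfrac13,0\right)$.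
   Context: A two-step variable step-size linear multistep method for $\dot x=g(x)$ has the form $x_{n+2}+\alpha_{1,n}x_{n+1}+\alpha_{0,n}x_n=h_{n+1}\sum_{j=0}^{2}\beta_{j,n}g(x_{n+j})$ with coefficients depending on $w_{n+1}$. Applied to Dahlquist's test equation $\dot x=\lambda x$, it reads, since $h_{n+1}(w_{n+1}-1)/w_{n+1}=h_{n+1}-h_n$, $$x_{n+2}+\alpha_{1,n}x_{n+1}+\alpha_{0,n}x_n=\mu_n\frac{w_{n+1}}{w_{n+1}-1}\big(\beta_{2,n}x_{n+2}+\beta_{1,n}x_{n+1}+\beta_{0,n}x_n\big).$$ Definition: the method is absolutely stable (for the given $\lambda$ and $\{h_n\}$) if $\mu_n$, $\alpha_{j,n}$ and $\frac{w_{n+1}}{w_{n+1}-1}\beta_{j,n}$ converge as $n\to\infty$, to limits $\mu$, $\alpha_j$ and $\widehat\beta_j$ respectively, and all the roots of the polynomial $$R(z)=(1-\mu\widehat\beta_2)z^2+(\alpha_1-\mu\widehat\beta_1)z+(\alpha_0-\mu\widehat\beta_0)$$ lie in the open unit disk. For the method in the claim, $\alpha_{1,n}=-(5-3w_{n+1})$, $\alpha_{0,n}=4-3w_{n+1}$, $\beta_{2,n}=0$, and the quantities $\frac{w_{n+1}}{w_{n+1}-1}\beta_{j,n}$ are, after cancellation, $20-12w_{n+1}$ for $j=1$ and $-(16-12w_{n+1})$ for $j=0$. *)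

(* Defs.v *)
From Stdlib Require Import Reals.
From Coquelicot Require Import Coquelicot.

Open Scope R_scope.

(** Two-step variable step-size linear multistep method: the coefficients are
    functions of the current step ratio [w_{n+1}]. *)
Record two_step_method := TwoStepMethod {
  alpha1 : R -> R;
  alpha0 : R -> R;
  beta2 : R -> R;
  beta1 : R -> R;
  beta0 : R -> R
}.

(** [w_n = h_n / h_{n-1}]; only the values at [n >= 1] are meaningful. *)
Definition step_ratio (h : nat -> R) (n : nat) : R := h n / h (Nat.pred n).

Definition solves_recurrence {V : ModuleSpace R_Ring} (m : two_step_method)
    (h : nat -> R) (g : V -> V) (x : nat -> V) : Prop :=
  forall n : nat,
    let w := step_ratio h (S n) in
    plus (plus (x (S (S n))) (scal (alpha1 m w) (x (S n))))
         (scal (alpha0 m w) (x n)) =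
    scal (h (S n))
      (plus (plus (scal (beta2 m w) (g (x (S (S n)))))
                  (scal (beta1 m w) (g (x (S n)))))
            (scal (beta0 m w) (g (x n)))).

(** [w / (w - 1) * beta w], understood after cancellation: at the removable
    singularity [w = 1] (two equal consecutive steps) it is the value obtained
    by continuity. *)
Definition beta_hat (beta : R -> R) (w : R) : R :=
  if Req_EM_T w 1
  then real (Lim (fun v : R => v / (v - 1) * beta v) 1)
  else w / (w - 1) * beta w.

Definition mu_seq (lambda : C) (h : nat -> R) (n : nat) : C :=
  (lambda * RtoC (h (S n) - h n))%C.

Definition roots_in_open_unit_disk (P : C -> C) : Prop :=
  forall z : C, P z = RtoC 0 -> Cmod z < 1.

Definition stability_poly (mu : C) (a1 a0 b2 b1 b0 : R) (z : C) : C :=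
  ((RtoC 1 - mu * RtoC b2) * z ^ 2 + (RtoC a1 - mu * RtoC b1) * z
   + (RtoC a0 - mu * RtoC b0))%C.

Definition absolutely_stable (m : two_step_method) (lambda : C)
    (h : nat -> R) : Prop :=
  exists (mu : C) (a1 a0 b2 b1 b0 : R),
    filterlim (mu_seq lambda h) eventually (locally mu) /\
    is_lim_seq (fun n => alpha1 m (step_ratio h (S n))) a1 /\
    is_lim_seq (fun n => alpha0 m (step_ratio h (S n))) a0 /\
    is_lim_seq (fun n => beta_hat (beta2 m) (step_ratio h (S n))) b2 /\
    is_lim_seq (fun n => beta_hat (beta1 m) (step_ratio h (S n))) b1 /\
    is_lim_seq (fun n => beta_hat (beta0 m) (step_ratio h (S n))) b0 /\
    roots_in_open_unit_disk (stability_poly mu a1 a0 b2 b1 b0).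

Definition vs_method : two_step_method :=
  {| alpha1 := fun w => - (5 - 3 * w);
     alpha0 := fun w => 4 - 3 * w;
     beta2 := fun _ => 0;
     beta1 := fun w => (w - 1) / w * (20 - 12 * w);
     beta0 := fun w => - ((w - 1) / w * (16 - 12 * w)) |}.

Lemma vs_method_recurrence {V : ModuleSpace R_Ring} (h : nat -> R)
    (g : V -> V) (x : nat -> V) :
  solves_recurrence vs_method h g x <->
  forall n : nat,
    let w := step_ratio h (S n) in
    plus (minus (x (S (S n))) (scal (5 - 3 * w) (x (S n))))
         (scal (4 - 3 * w) (x n)) =
    scal (h (S n) * ((w - 1) / w))
      (minus (scal (20 - 12 * w) (g (x (S n))))
             (scal (16 - 12 * w) (g (x n)))).
Proof.
assert (El : forall (a : R) (u v y : V),
  plus (plus u (scal (- a) v)) y = plus (minus u (scal a v)) y).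
{ intros a u v y; change (- a) with (@opp R_Ring a).
  now rewrite scal_opp_l. }
assert (Er : forall (a b c d : R) (u v y : V),
  scal a (plus (plus (scal 0 u) (scal (b * c) v)) (scal (- (b * d)) y)) =
  scal (a * b) (minus (scal c v) (scal d y))).
{ intros a b c d u v y.
  change (- (b * d)) with (@opp R_Ring (mult b d)).
  change (b * c) with (@mult R_Ring b c).
  change (a * b) with (@mult R_Ring a b).
  change 0 with (@zero R_Ring).
  rewrite scal_zero_l, plus_zero_l, scal_opp_l, <- !scal_assoc.
  unfold minus.
  now rewrite <- scal_opp_r, <- scal_distr_l. }
split; intros H n; specialize (H n); cbv zeta in *;
  cbn [vs_method alpha1 alpha0 beta2 beta1 beta0] in *.
- now rewrite <- El, <- (Er _ _ _ _ (g (x (S (S n))))).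
- now rewrite El, Er.
Qed.

(* Main.v *)
(** Since [Re lambda < 0], convergence of [mu_n] forces [h_{n+1} - h_n] to
    converge to some [d], and positivity of the steps gives [d >= 0].  If
    [d = 0] then [mu = 0], and in either polynomial the point [z = 1] is a
    root, which both conditions exclude.  If [d > 0] then [h_n] tends to
    infinity, so [w_n = 1 + (h_n - h_{n-1}) / h_{n-1}] tends to [1], and at
    [w = 1] the stability polynomial is [z^2 - 2(1+4mu)z + (1+4mu)]. *)

Require Import Defs.
From Stdlib Require Import Reals Lra Lia.
From Coquelicot Require Import Coquelicot.

Open Scope R_scope.

Lemma filterlim_Re (u : nat -> C) (l : C) :
  filterlim u eventually (locally l) -> is_lim_seq (fun n => Re (u n)) (Re l).
Proof.
intros H; apply (filterlim_comp _ _ _ u fst _ (locally l)); [exact H|].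
destruct l as [a b]; intros P [eps HP]; exists eps; intros y [Hy _]; now apply HP.
Qed.

Lemma filterlim_Im (u : nat -> C) (l : C) :
  filterlim u eventually (locally l) -> is_lim_seq (fun n => Im (u n)) (Im l).
Proof.
intros H; apply (filterlim_comp _ _ _ u snd _ (locally l)); [exact H|].
destruct l as [a b]; intros P [eps HP]; exists eps; intros y [_ Hy]; now apply HP.
Qed.

(** The real part of [mu_seq] is the increment times [Re lambda], which is nonzero and can be
    divided out, so [d] is [Re mu / Re lambda]. *)
Lemma increment_lim_of_mu_seq (lambda mu : C) (h : nat -> R) :
  Re lambda < 0 ->
  filterlim (mu_seq lambda h) eventually (locally mu) ->
  exists d : R, is_lim_seq (fun n => h (S n) - h n) d /\ mu = (lambda * RtoC d)%C.
Proof.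
intros Hl H; pose proof (filterlim_Re _ _ H) as Hre.
pose proof (filterlim_Im _ _ H) as Him; clear H.
exists (Re mu / Re lambda).
assert (Hd : is_lim_seq (fun n => h (S n) - h n) (Re mu / Re lambda)).
{ apply (is_lim_seq_scal_r _ (/ Re lambda) (Re mu)) in Hre.
  revert Hre; apply is_lim_seq_ext; intros n.
  unfold mu_seq, Re, Im in *; simpl; field; lra. }
split; [exact Hd|].
(* The imaginary parts have two expressions for their limit, and uniqueness equates them. *)
assert (Heq : Im mu = Im lambda * (Re mu / Re lambda)).
{ apply (is_lim_seq_scal_l _ (Im lambda) (Re mu / Re lambda)) in Hd.
  enough (Finite (Im mu) = Finite (Im lambda * (Re mu / Re lambda))) by congruence.
  rewrite <- (is_lim_seq_unique _ _ Him); apply is_lim_seq_unique.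
  revert Hd; apply is_lim_seq_ext; intros n.
  unfold mu_seq, Re, Im; simpl; ring. }
destruct mu as [a b], lambda as [p q]; unfold Cmult, RtoC, Re, Im in *; simpl in *.
apply injective_projections; simpl; [field; lra|rewrite Heq; ring].
Qed.

(** Telescoping sum of increments that stay within [eps] of [d] from [N] on. The upper bound serves
    to rule out [d < 0], the lower one to get divergence when [d > 0]. *)
Lemma eventually_linear_growth (h : nat -> R) (d : R) :
  is_lim_seq (fun n => h (S n) - h n) d ->
  forall eps : posreal, exists N, forall n,
    h N + INR n * (d - eps) <= h (N + n)%nat <= h N + INR n * (d + eps).
Proof.
intros H eps; apply is_lim_seq_spec in H; destruct (H eps) as [N HN].
exists N; induction n as [|n IH].
- rewrite Nat.add_0_r; simpl; lra.
- specialize (HN (N + n)%nat ltac:(lia)); apply Rabs_def2 in HN.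
  rewrite Nat.add_succ_r, S_INR; lra.
Qed.

Lemma increment_lim_nonneg (h : nat -> R) (d : R) :
  (forall n, 0 < h n) -> is_lim_seq (fun n => h (S n) - h n) d -> 0 <= d.
Proof.
intros Hh H; destruct (Rle_or_lt 0 d) as [|Hd]; [assumption|exfalso].
(* With this tolerance the upper line has slope [d / 2 < 0] and eventually drops below zero. *)
assert (Hp : 0 < - d / 2) by lra.
destruct (eventually_linear_growth h d H (mkposreal _ Hp)) as [N HN]; simpl in HN.
destruct (INR_unbounded (h N / (- d / 2))) as [n Hn].
apply Rmult_gt_compat_r with (r := - d / 2) in Hn; [|lra].
replace (h N / (- d / 2) * (- d / 2)) with (h N) in Hn by (field; lra).
specialize (HN n); specialize (Hh (N + n)%nat); lra.
Qed.

Lemma step_ratio_lim (h : nat -> R) (d : R) :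
  (forall n, 0 < h n) -> is_lim_seq (fun n => h (S n) - h n) d -> 0 < d ->
  is_lim_seq (fun n => step_ratio h (S n)) 1.
Proof.
intros Hh H Hd.
assert (Hinf : is_lim_seq h p_infty).
{ assert (Hp : 0 < d / 2) by lra.
  destruct (eventually_linear_growth h d H (mkposreal _ Hp)) as [N HN]; simpl in HN.
  apply (is_lim_seq_incr_n _ N), is_lim_seq_spec; intros M.
  destruct (INR_unbounded (M / (d / 2))) as [n0 Hn0]; exists n0; intros n Hn.
  apply le_INR in Hn; apply Rmult_gt_compat_r with (r := d / 2) in Hn0; [|lra].
  replace (M / (d / 2) * (d / 2)) with M in Hn0 by (field; lra).
  specialize (HN n); specialize (Hh N); rewrite Nat.add_comm; nra. }
assert (Hinv : is_lim_seq (fun n => / h n) 0)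
  by (apply (is_lim_seq_inv h p_infty); [exact Hinf|discriminate]).
pose proof (is_lim_seq_plus' _ _ _ _ (is_lim_seq_const 1)
  (is_lim_seq_mult' _ _ _ _ H Hinv)) as L.
rewrite Rmult_0_r, Rplus_0_r in L.
revert L; apply is_lim_seq_ext; intros n; unfold step_ratio; simpl.
specialize (Hh n); field; lra.
Qed.

(** At [w = 1] the limit sees only a punctured neighbourhood, where the quotient already equals [f];
    continuity of [f] then gives the value [f 1]. *)
Lemma beta_hat_cancel (b f : R -> R) (w : R) :
  continuous f 1 ->
  (forall v, v <> 0 -> v <> 1 -> v / (v - 1) * b v = f v) ->
  w <> 0 -> beta_hat b w = f w.
Proof.
intros Hf Hb Hw; unfold beta_hat; destruct (Req_EM_T w 1) as [->|Hw1]; [|now apply Hb].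
rewrite (is_lim_unique _ 1 (f 1)); [reflexivity|].
apply (is_lim_ext_loc f).
(* Radius 1 around 1 keeps [y] away from the other singularity, 0. *)
- assert (Hp : 0 < 1) by lra; exists (mkposreal _ Hp); intros y Hy Hy1; symmetry.
  apply Hb; [|exact Hy1]; intros ->.
  apply Rabs_def2 in Hy; unfold minus, plus, opp in Hy; simpl in Hy; lra.
- now apply is_lim_continuity, continuity_pt_filterlim.
Qed.

Lemma vs_beta2_hat (w : R) : w <> 0 -> beta_hat (beta2 vs_method) w = 0.
Proof.
apply (beta_hat_cancel _ (fun _ => 0)); [apply continuous_const|].
intros v _ _; simpl; ring.
Qed.

Lemma vs_beta1_hat (w : R) : w <> 0 -> beta_hat (beta1 vs_method) w = 20 - 12 * w.
Proof.
apply (beta_hat_cancel _ (fun v => 20 - 12 * v)).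
- apply (@ex_derive_continuous R_AbsRing R_NormedModule); auto_derive; trivial.
- intros v H0 H1; simpl; field; split; lra.
Qed.

Lemma vs_beta0_hat (w : R) : w <> 0 -> beta_hat (beta0 vs_method) w = - (16 - 12 * w).
Proof.
apply (beta_hat_cancel _ (fun v => - (16 - 12 * v))).
- apply (@ex_derive_continuous R_AbsRing R_NormedModule); auto_derive; trivial.
- intros v H0 H1; simpl; field; split; lra.
Qed.

Lemma vs_coefficients_lim (w : nat -> R) (l : R) :
  (forall n, w n <> 0) -> is_lim_seq w l ->
  is_lim_seq (fun n => alpha1 vs_method (w n)) (- (5 - 3 * l)) /\
  is_lim_seq (fun n => alpha0 vs_method (w n)) (4 - 3 * l) /\
  is_lim_seq (fun n => beta_hat (beta2 vs_method) (w n)) 0 /\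
  is_lim_seq (fun n => beta_hat (beta1 vs_method) (w n)) (20 - 12 * l) /\
  is_lim_seq (fun n => beta_hat (beta0 vs_method) (w n)) (- (16 - 12 * l)).
Proof.
intros Hw L.
assert (A : forall a b, is_lim_seq (fun n => a - b * w n) (a - b * l)).
{ intros a b; apply is_lim_seq_minus'; [apply is_lim_seq_const|].
  now apply (is_lim_seq_scal_l w b l). }
assert (B : forall a b, is_lim_seq (fun n => - (a - b * w n)) (- (a - b * l))).
{ intros a b; exact (proj1 (is_lim_seq_opp _ _) (A a b)). }
split; [apply B|split; [apply A|]].
split; [|split].
- apply is_lim_seq_ext with (fun _ => 0); [|apply is_lim_seq_const].
  intros n; now rewrite vs_beta2_hat.
- apply is_lim_seq_ext with (fun n => 20 - 12 * w n); [|apply A].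
  intros n; now rewrite vs_beta1_hat.
- apply is_lim_seq_ext with (fun n => - (16 - 12 * w n)); [|apply B].
  intros n; now rewrite vs_beta0_hat.
Qed.

Lemma vs_stability_poly_at_1 (mu z : C) :
  stability_poly mu (- (5 - 3 * 1)) (4 - 3 * 1) 0 (20 - 12 * 1) (- (16 - 12 * 1)) z =
  (z ^ 2 - RtoC 2 * (RtoC 1 + RtoC 4 * mu) * z + (RtoC 1 + RtoC 4 * mu))%C.
Proof.
destruct mu, z; apply injective_projections; simpl; ring.
Qed.

Lemma not_root_1 (P : C -> C) :
  roots_in_open_unit_disk P -> P (RtoC 1) <> RtoC 0.
Proof.
intros HP H1; apply HP in H1; rewrite Cmod_1 in H1; lra.
Qed.

Lemma roots_in_open_unit_disk_ext (P Q : C -> C) :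
  (forall z, P z = Q z) -> roots_in_open_unit_disk P -> roots_in_open_unit_disk Q.
Proof.
intros E HP z Hz; apply HP; now rewrite E.
Qed.

(** The values at [z = 1] and [z = -1] are [1 - c] and [1 + 3 * c]; the two bounds on [c] say that
    both are positive. Outside these bounds the discriminant is nonnegative and a real root lies
    outside the open disk. *)
Lemma real_quadratic_roots_in_disk (c : R) :
  roots_in_open_unit_disk (fun z : C => (z ^ 2 - RtoC 2 * RtoC c * z + RtoC c)%C) <->
  - (1 / 3) < c < 1.
Proof.
split.
- intros H.
  assert (Hr : forall x : R, x ^ 2 - 2 * c * x + c = 0 -> Rabs x < 1).
  { intros x Hx; rewrite <- Cmod_R; apply H.
    rewrite <- Hx; apply injective_projections; simpl; ring. }
  clear H.
  destruct (Rle_or_lt 1 c) as [H1|H1]; [exfalso|].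
  { assert (Hs : 0 <= c ^ 2 - c) by nra.
    pose proof (pow2_sqrt _ Hs); pose proof (sqrt_pos (c ^ 2 - c)).
    (* The larger real root is at least [c], hence at least 1. *)
    specialize (Hr (c + sqrt (c ^ 2 - c)) ltac:(nra)).
    apply Rabs_def2 in Hr; lra. }
  destruct (Rle_or_lt c (- (1 / 3))) as [H2|H2]; [exfalso|lra].
  assert (Hs : 0 <= c ^ 2 - c) by nra.
  pose proof (pow2_sqrt _ Hs) as Hq; pose proof (sqrt_pos (c ^ 2 - c)).
  (* For [c <= -1/3], [c ^ 2 - c] is at least [1/9 + 1/3 = 4/9], so the smaller root is at most
     [-1]. *)
  assert (2 / 3 <= sqrt (c ^ 2 - c)) by nra.
  specialize (Hr (c - sqrt (c ^ 2 - c)) ltac:(nra)).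
  apply Rabs_def2 in Hr; lra.
- intros [Hc1 Hc2] [x y] Hz.
  assert (E1 : x ^ 2 - y ^ 2 - 2 * c * x + c = 0)
    by (apply (f_equal fst) in Hz; simpl in Hz; rewrite <- Hz; ring).
  assert (E2 : 2 * y * (x - c) = 0)
    by (apply (f_equal snd) in Hz; simpl in Hz; rewrite <- Hz; ring).
  clear Hz; unfold Cmod; simpl fst; simpl snd.
  rewrite <- sqrt_1; apply sqrt_lt_1_alt; split; [nra|].
  destruct (Req_dec y 0) as [->|Hy].
  (* The polynomial is [x^2 - c(2x - 1)]. For [x >= 1] it exceeds [(x - 1)^2] since [c < 1]; for
     [x <= -1] it exceeds [(3x - 1)(x + 1)/3 >= 0] since [c > -1/3]. *)
  + assert (-1 < x < 1) by (split; apply Rnot_le_lt; intros Hx; nra).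
    nra.
  + (* A nonreal root has [|z|^2 = c], the product of the conjugate pair. *)
    assert (x = c) by (apply Rmult_integral in E2; lra).
    subst x; nra.
Qed.

Theorem theorem3p3 (lambda : C) (h : nat -> R)
    (Hlambda : Re lambda < 0) (Hh : forall n : nat, 0 < h n) :
  (absolutely_stable vs_method lambda h <->
   exists mu : C,
     filterlim (mu_seq lambda h) eventually (locally mu) /\
     roots_in_open_unit_disk
       (fun z : C => (z ^ 2 - RtoC 2 * (RtoC 1 + RtoC 4 * mu) * z
                      + (RtoC 1 + RtoC 4 * mu))%C)) /\
  (forall mu : R,
     roots_in_open_unit_disk
       (fun z : C => (z ^ 2 - RtoC 2 * (RtoC 1 + RtoC 4 * RtoC mu) * z
                      + (RtoC 1 + RtoC 4 * RtoC mu))%C) <->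
     - (1 / 3) < mu < 0).
Proof.
assert (Hw : forall n, step_ratio h (S n) <> 0).
{ intros n; apply Rgt_not_eq, Rdiv_lt_0_compat; apply Hh. }
split; [split|].
- intros (mu & a1 & a0 & b2 & b1 & b0 & Hmu & L1 & L0 & M2 & M1 & M0 & HR).
  exists mu; split; [exact Hmu|].
  destruct (increment_lim_of_mu_seq _ _ _ Hlambda Hmu) as (d & Hd & Emu).
  destruct (increment_lim_nonneg _ _ Hh Hd) as [Hpos|<-].
  + destruct (vs_coefficients_lim _ _ Hw (step_ratio_lim h d Hh Hd Hpos))
      as (L1' & L0' & M2' & M1' & M0').
    (* Stability only provides some limits; uniqueness identifies them with the coefficients at
       ratio 1. *)
    assert (U : forall u (l l' : R), is_lim_seq u l -> is_lim_seq u l' -> l = l').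
    { intros u l l' K K'; apply is_lim_seq_unique in K, K'; congruence. }
    rewrite (U _ _ _ L1 L1'), (U _ _ _ L0 L0'), (U _ _ _ M2 M2'),
      (U _ _ _ M1 M1'), (U _ _ _ M0 M0') in HR.
    revert HR; apply roots_in_open_unit_disk_ext, vs_stability_poly_at_1.
  + (* [alpha1 + alpha0 = -1] for every ratio, hence also in the limit. *)
    exfalso; apply (not_root_1 _ HR).
    assert (E : a1 + a0 = -1).
    { pose proof (is_lim_seq_unique _ _ (is_lim_seq_plus' _ _ _ _ L1 L0)) as E.
      rewrite (Lim_seq_ext _ (fun _ => -1)), Lim_seq_const in E
        by (intros n; simpl; ring).
      congruence. }
    (* With [mu = 0] the value at [z = 1] is [1 + a1 + a0], whatever the limit of the ratios. *)
    unfold stability_poly; rewrite Emu, Cmult_0_r, !Cmult_0_l.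
    apply injective_projections; simpl; [lra|ring].
- intros (mu & Hmu & HR).
  destruct (increment_lim_of_mu_seq _ _ _ Hlambda Hmu) as (d & Hd & Emu).
  destruct (increment_lim_nonneg _ _ Hh Hd) as [Hpos|<-].
  + pose proof (vs_coefficients_lim _ _ Hw (step_ratio_lim h d Hh Hd Hpos)) as HL.
    exists mu, (- (5 - 3 * 1)), (4 - 3 * 1), 0, (20 - 12 * 1), (- (16 - 12 * 1)).
    split; [exact Hmu|].
    destruct HL as (L1 & L0 & M2 & M1 & M0); repeat (split; [assumption|]).
    revert HR; apply roots_in_open_unit_disk_ext; intros z.
    symmetry; apply vs_stability_poly_at_1.
  (* For [mu = 0] the polynomial is [(z - 1)^2]. *)
  + exfalso; apply (not_root_1 _ HR); rewrite Emu, Cmult_0_r.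
    apply injective_projections; simpl; ring.
- intros mu.
  (* Here [c = 1 + 4 * mu], so [-1/3 < c < 1] becomes [-1/3 < mu < 0]. *)
  rewrite <- RtoC_mult, <- RtoC_plus, real_quadratic_roots_in_disk; lra.
Qed.
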